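(* Let $F:[1,\infty)\to[0,\infty)$ be an increasing function. In the competitive scepticism protocol, Rival Sceptic can ensure $$\mathcal K'_t\ge F(\mathcal K^*_t),\quad t=1,2,\dots,$$ if and only if $F$ is an SLA. More generally, let $c\in[0,1)$. Rival Sceptic can ensure $$\mathcal K'_t\ge c\,\mathcal K_t+F(\mathcal K_t^* )\quad\text{for all } t$$ if and only if $F/(1-c)$ is an SLA.
   Context: ''Increasing'' and ''positive'' are meant in the non-strict sense. $\overline{\mathbb R}:=[-\infty,\infty]$ with the convention $\infty+(-\infty):=\infty$. Let $\mathcal X$ be a set containing at least two distinct elements. An outer probability content on $\mathcal X$ is a function $\mathcal E:\overline{\mathbb R}^{\mathcal X}\to\overline{\mathbb R}$ such that: (1) $f\le g$ implies $\mathcal E(f)\le\mathcal E(g)$; (2) $\mathcal E(cf)=c\,\mathcal E(f)$ for $c\in(0,\infty)$; (3) $\mathcal E(f+g)\le\mathcal E(f)+\mathcal E(g)$; (4) $\mathcal E(c)=c$ for every constant $c\in\mathbb R$ (viewed as a constant function). Let $\mathbf E$ be the set of all outer probability contents on $\mathcal X$. Competitive scepticism protocol (perfect information, with parameter $\mathcal X$): $\mathcal K_0:=1$, $\mathcal K'_0:=1$. For $t=1,2,\dots$, in this order: Forecaster announces $\mathcal E_t\in\mathbf E$; Sceptic announces $f_t\in[0,\infty]^{\mathcal X}$ with $\mathcal E_t(f_t)\le\mathcal K_{t-1}$; Rival Sceptic announces $f'_t\in[0,\infty]^{\mathcal X}$ with $\mathcal E_t(f'_t)\le\mathcal K'_{t-1}$;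 Reality announces $x_t\in\mathcal X$; then $\mathcal K_t:=f_t(x_t)$ and $\mathcal K'_t:=f'_t(x_t)$. Put $\mathcal K_t^*:=\max_{s\le t}\mathcal K_s$. ''Rival Sceptic can ensure'' a property means he has a strategy (his moves being functions of all the moves made before) under which the property holds whatever legal moves the other players make. Conventions: $F(\infty):=\lim_{y\to\infty}F(y)$ and $0\cdot\infty:=0$. SLA (simple lookback adjuster): consider the game with $X_0:=1$, $\mathcal C_0:=1$ in which, for $t=1,2,\dots$, Investor announces $p_t\in\mathbb R$, then Market announces $X_t\in[0,\infty)$, and $\mathcal C_t:=\mathcal C_{t-1}+p_t(X_t-X_{t-1})$. An increasing function $F:[1,\infty)\to[0,\infty)$ is an SLA if Investor has a strategy (with $p_t$ a function of $X_1,\dots,X_{t-1}$) that guarantees $\mathcal C_t\ge F(\max_{s\le t}X_s)$ for all $t$, for every sequence of Market's moves. *)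

(* Defs.v *)
From mathcomp Require Export all_boot all_order all_algebra.
From mathcomp Require Export all_classical all_reals all_analysis.

Set Implicit Arguments.
Unset Strict Implicit.
Unset Printing Implicit Defensive.

Import Order.TTheory GRing.Theory Num.Theory.
Import numFieldNormedType.Exports.

Local Open Scope classical_set_scope.
Local Open Scope ring_scope.
Local Open Scope ereal_scope.

Section CompetitiveScepticism.
Variables (R : realType) (X : Type).

(* [dual_adde] is the addition with oo + (-oo) = oo; the default addition of
   \bar R has oo + (-oo) = -oo instead. *)
Definition outer_probability_content (E : (X -> \bar R) -> \bar R) : Prop :=
  [/\ forall f g, (forall x, f x <= g x) -> E f <= E g,
      forall (c : R) f, (0 < c)%R -> E (fun x => c%:E * f x) = c%:E * E f,
      forall f g, E (fun x => dual_adde (f x) (g x)) <= dual_adde (E f) (E g)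
    & forall c : R, E (fun=> c%:E) = c%:E].

Record round := Round {
  forecast : (X -> \bar R) -> \bar R;
  sceptic : X -> \bar R;
  rival : X -> \bar R;
  reality : X }.

(* The item of index [t] of a play is round [t.+1] of the protocol. *)
Definition play := nat -> round.

Definition capital (w : play) (t : nat) : \bar R :=
  if t is s.+1 then sceptic (w s) (reality (w s)) else 1.

Definition rival_capital (w : play) (t : nat) : \bar R :=
  if t is s.+1 then rival (w s) (reality (w s)) else 1.

Definition max_capital (w : play) (t : nat) : \bar R :=
  \big[maxe/-oo]_(s < t.+1) capital w s.

Definition legal_bet (E : (X -> \bar R) -> \bar R) (f : X -> \bar R)
    (K : \bar R) : Prop :=
  (forall x, 0 <= f x) /\ E f <= K.

(* Arguments: the completed rounds, then the moves of Forecaster and of Sceptic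
   in the current round. *)
Definition rival_strategy :=
  seq round -> ((X -> \bar R) -> \bar R) -> (X -> \bar R) -> (X -> \bar R).

Definition rival_follows (S : rival_strategy) (w : play) : Prop :=
  forall t, rival (w t) = S (mkseq w t) (forecast (w t)) (sceptic (w t)).

Definition opponents_legal (w : play) : Prop :=
  forall t, outer_probability_content (forecast (w t)) /\
            legal_bet (forecast (w t)) (sceptic (w t)) (capital w t).

Definition rival_legal (w : play) : Prop :=
  forall t, legal_bet (forecast (w t)) (rival (w t)) (rival_capital w t).

Definition rival_can_ensure (P : play -> Prop) : Prop :=
  exists S : rival_strategy, forall w : play,
    rival_follows S w -> opponents_legal w -> rival_legal w /\ P w.

End CompetitiveScepticism.

Section Lookback.
Variable R : realType.

(* Functions [1, oo) -> [0, oo) are represented by functions on R, whose values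
   outside [1, oo) are irrelevant. *)
Definition increasing_from1 (F : R -> R) : Prop :=
  (forall x, (1 <= x)%R -> (0 <= F x)%R) /\
  (forall x y, (1 <= x)%R -> (x <= y)%R -> (F x <= F y)%R).

(* F extended by F(oo) := lim_(y -> oo) F(y); only used on [1, oo]. *)
Definition extend_oo (F : R -> R) (x : \bar R) : \bar R :=
  match x with
  | r%:E => (F r)%:E
  | +oo => lim ((F y)%:E @[y --> +oo%R])
  | -oo => 0
  end.

Definition investor_strategy := seq R -> R.

(* [X t] is X_t; the history passed to the strategy at step t+1 is
   X_1, ..., X_t. *)
Fixpoint investor_capital (p : investor_strategy) (X : nat -> R) (t : nat) : R :=
  (if t is s.+1 then
     investor_capital p X s
       + p [seq X i | i <- iota 1 s] * (X s.+1 - X s)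
   else 1)%R.

Definition running_max (X : nat -> R) (t : nat) : R :=
  \big[Num.max/X 0%N]_(s < t.+1) X s.

Definition SLA (F : R -> R) : Prop :=
  increasing_from1 F /\
  exists p : investor_strategy, forall X : nat -> R,
    X 0%N = 1%R -> (forall t, 0 <= X t)%R ->
    forall t, (F (running_max X t) <= investor_capital p X t)%R.

End Lookback.

(* Main.v *)
(** If Investor's strategy [p] guarantees [C_t >= F (max X) / (1 - c)], its
    positions are nonnegative (Market could let [X_t] tend to infinity), so
    Rival can afford [c f_t + (1 - c) (C_(t-1) + p_t (f_t - K_(t-1)))]; when
    Sceptic's capital becomes infinite, either so does Rival's, or [c = p_t = 0]
    and his capital already dominates all the values of [F].

    Conversely, let Sceptic's capital run through [1 = y_0 <= y_1 <= ...], at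
    each step with the risk of dropping to 0 that makes the bet fair. Rival must
    hold [F (y_i)] at ruin, so the expectation of his capital yields
    [sum_i F (y_i) (1 / y_i - 1 / y_(i+1)) + F (y_n) / y_n <= 1 - c]. The
    supremum of such sums starting from [m] plays the part of the integral of
    [F u / u ^ 2] over [[m, oo)], and gives an Azema-Yor strategy for Investor. *)
Require Import Defs.
From mathcomp Require Import ring lra.
Import Order.TTheory GRing.Theory Num.Theory.
Import numFieldNormedType.Exports.
Import DualAddTheory.
Local Open Scope classical_set_scope.
Local Open Scope ring_scope.
Local Open Scope ereal_scope.

Set Implicit Arguments.
Unset Strict Implicit.
Unset Printing Implicit Defensive.

(** * Investor's game: running maxima, and the sign of his positions *)

Section InvestorGame.
Variable R : realType.
Implicit Types (F : R -> R) (p : investor_strategy R) (X Y : nat -> R).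
Local Open Scope ring_scope.

Lemma le_running_max X s t : (s <= t)%N -> X s <= running_max X t.
Proof. by move=> st; rewrite /running_max (le_bigmax _ _ (Ordinal (_ : s < t.+1)%N)). Qed.

Lemma running_maxS X t :
  running_max X t.+1 = Num.max (running_max X t) (X t.+1).
Proof.
apply/le_anti/andP; split; last first.
  rewrite ge_max le_running_max// andbT; apply: bigmax_le => [|i _].
    exact: le_running_max.
  by apply: le_running_max; rewrite ltnW.
apply: bigmax_le => [|[i /= it] _]; first by rewrite le_max le_running_max.
rewrite le_max; move: it; rewrite ltnS leq_eqVlt => /orP[/eqP->|it].
  by rewrite lexx orbT.
by rewrite le_running_max.
Qed.

Lemma running_max0 X : running_max X 0 = X 0%N.
Proof. by rewrite /running_max big_ord_recl big_ord0 maxxx. Qed.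

Lemma investor_capital_eq p X Y t : (forall s, (s <= t)%N -> X s = Y s) ->
  investor_capital p X t = investor_capital p Y t.
Proof.
elim: t => //= t IH XY; rewrite IH => [|s st]; last by rewrite XY// leqW.
rewrite !XY//; congr (_ + p _ * _); apply/eq_in_map => s.
by rewrite mem_iota add1n ltnS => /andP[_ st]; rewrite XY// leqW.
Qed.

(* The guarantee, for Market's sequence changed to jump to [y] after round [t]. *)
Lemma SLA_jump F p X t (y : R) :
  (forall x y, 1 <= x -> x <= y -> F x <= F y) ->
  (forall X, X 0%N = 1 -> (forall t, 0 <= X t) ->
    forall t, F (running_max X t) <= investor_capital p X t) ->
  X 0%N = 1 -> (forall t, 0 <= X t) -> 0 <= y ->
  let C := investor_capital p X t + p [seq X i | i <- iota 1 t] * (y - X t) in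
  F 1 <= C /\ (1 <= y -> F y <= C).
Proof.
move=> Fmon pF X0 Xge0 y0 C.
pose Y s := if (s <= t)%N then X s else y.
have YX s : (s <= t)%N -> X s = Y s by rewrite /Y => ->.
have Ynext : Y t.+1 = y by rewrite /Y ltnn.
have CE : investor_capital p Y t.+1 = C.
  rewrite /= Ynext -YX// /C (investor_capital_eq p YX); congr (_ + p _ * _).
  apply/eq_in_map => s; rewrite mem_iota add1n ltnS => /andP[_ st].
  by rewrite YX.
have Y0 : Y 0%N = 1 by rewrite -YX.
have Yge0 s : 0 <= Y s by rewrite /Y; case: ifP.
have FC := pF Y Y0 Yge0 t.+1; rewrite CE in FC.
split=> [|y1]; apply: le_trans FC; apply: Fmon => //.
  by rewrite -Y0 le_running_max.
by rewrite -Ynext le_running_max.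
Qed.

(** A negative position would lose without bound on a large enough rise of the price, while the
    guarantee keeps the capital above [F 1 >= 0]. *)
Lemma SLA_position_ge0 F p X t : increasing_from1 F ->
  (forall X, X 0%N = 1 -> (forall t, 0 <= X t) ->
    forall t, F (running_max X t) <= investor_capital p X t) ->
  X 0%N = 1 -> (forall t, 0 <= X t) ->
  0 <= p [seq X i | i <- iota 1 t].
Proof.
move=> [Fge0 Fmon] pF X0 Xge0; rewrite leNgt; apply/negP => p0.
have F1 : 0 <= F 1 by apply: Fge0.
set q := p _ in p0; set C := investor_capital p X t.
(* The jump to this price loses exactly one plus the absolute value of [C], which leaves at most
   [-1]. *)
pose y := X t + (1 + `|C|) / - q.
have q0 : 0 < - q by rewrite oppr_gt0.
have y0 : 0 <= y by rewrite addr_ge0// divr_ge0 ?addr_ge0// ltW.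
have [+ _] := SLA_jump t Fmon pF X0 Xge0 y0.
rewrite -/q -/C /y addrAC subrr add0r invrN mulrN mulrN mulrCA mulfV ?lt_eqF//.
by have := ler_norm C; lra.
Qed.

End InvestorGame.

(** * The maximum of Sceptic's capital *)

Section Plays.
Variables (R : realType) (X : Type).
Implicit Types (w : play R X).

Lemma le_max_capital w s t : (s <= t)%N -> capital w s <= max_capital w t.
Proof.
by move=> st; rewrite /max_capital (le_bigmax _ _ (Ordinal (_ : s < t.+1)%N)).
Qed.

Lemma max_capital_running_max w (Y : nat -> R) t :
  (forall s, (s <= t)%N -> capital w s = (Y s)%:E) ->
  max_capital w t = (running_max Y t)%:E.
Proof.
move=> wY; apply/le_anti/andP; split.
  apply: bigmax_le => [|[i /= it] _]; first exact: leNye.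
  by rewrite wY// lee_fin le_running_max.
have [s st ->] : exists2 s, (s <= t)%N & running_max Y t = Y s.
  elim: t {wY} => [|t [s st IH]]; first by exists 0%N; rewrite ?running_max0.
  rewrite running_maxS IH; case: leP => _; first by exists t.+1.
  by exists s => //; rewrite leqW.
by rewrite -wY// le_max_capital.
Qed.

End Plays.

(** * From an SLA to a strategy for Rival Sceptic *)

Section SLAToRival.
Variables (R : realType) (X : Type).
Implicit Types (w : play R X) (E : (X -> \bar R) -> \bar R) (f : X -> \bar R).

Lemma extend_oo_le (F : R -> R) (K : \bar R) :
  (forall x y, (1 <= x)%R -> (x <= y)%R -> (F x <= F y)%R) ->
  (forall y, (1 <= y)%R -> (F y)%:E <= K) -> extend_oo F +oo <= K.
Proof.
move=> Fmon FK /=.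
(* [F] is arbitrary below 1; composing with [Num.max 1] makes it monotone on the whole line, so that
   the limit exists, and does not change its germ at infinity. *)
have -> : lim ((F y)%:E @[y --> +oo%R])
    = lim ((F (Num.max 1 y)%R)%:E @[y --> +oo%R]).
  congr lim; apply/seteqP; split; apply: near_eq_cvg; near=> y;
    by rewrite max_r//; near: y; exact: nbhs_pinfty_ge.
apply: lime_le.
  apply: nondecreasing_is_cvge => x y xy; rewrite lee_fin.
  by apply: Fmon; [rewrite le_max lexx|exact: le_max2].
by apply: nearW => y; apply: FK; rewrite le_max lexx.
Unshelve. all: by end_near. Qed.

Lemma dual_adde_finl (r : R) (y : \bar R) : dual_adde r%:E y = r%:E + y.
Proof. by case: y. Qed.

Lemma content_affine E f (r a K : R) :
  outer_probability_content E -> (0 <= a)%R -> E f <= K%:E ->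
  E (fun x => r%:E + a%:E * f x) <= (r + a * K)%:E.
Proof.
move=> [_ EZ ED Ec]; rewrite le_eqVlt => /predU1P[<- _|a0 EfK].
  (* Homogeneity covers positive factors only, so [a = 0] rests on [0 * oo = 0] and the value on
     constants. *)
  by under eq_fun do rewrite mul0e adde0; rewrite Ec mul0r addr0.
under eq_fun do rewrite -dual_adde_finl.
apply: le_trans (ED _ _) _; rewrite Ec EZ// dual_adde_finl EFinD EFinM.
by rewrite leeD2l// lee_pmul2l.
Qed.

(* Rival invests [c] in copying Sceptic and [1 - c] in imitating Investor on
   Sceptic's capital; he freezes his capital once Sceptic's has reached [+oo]. *)
Definition imitate (c : R) (p : investor_strategy R) : rival_strategy R X :=
  fun h _ f =>
    let Ks := [seq sceptic r (reality r) | r <- h] in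
    let K' := last 1 [seq rival r (reality r) | r <- h] in
    if +oo \in Ks then fun=> K' else
    let a := (c + (1 - c) * p [seq fine K | K <- Ks])%R in
    fun x => (fine K' - a * fine (last 1%E Ks))%:E + a%:E * f x.

Lemma capitals_mkseq w t :
  [seq sceptic r (reality r) | r <- mkseq w t]
    = [seq capital w s | s <- iota 1 t].
Proof. by rewrite -[1%N]addn0 iotaDl -!map_comp. Qed.

Lemma last_capitals w t :
  last 1 [seq sceptic r (reality r) | r <- mkseq w t] = capital w t.
Proof. by case: t => // t; rewrite mkseqS map_rcons last_rcons. Qed.

Lemma last_rival_capitals w t :
  last 1 [seq rival r (reality r) | r <- mkseq w t] = rival_capital w t.
Proof. by case: t => // t; rewrite mkseqS map_rcons last_rcons. Qed.

(** * The invariant of the imitating strategy *)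

Section Imitation.
Variables (F : R -> R) (c : R) (p : investor_strategy R) (w : play R X).
Hypotheses (c0 : (0 <= c)%R) (c1 : (c < 1)%R) (F_incr : increasing_from1 F).
Let G (y : R) := (F y / (1 - c))%R.
Hypothesis pG : forall X : nat -> R, X 0%N = 1%R -> (forall t, 0 <= X t)%R ->
  forall t, (G (running_max X t) <= investor_capital p X t)%R.
Hypotheses (wS : rival_follows (imitate c p) w) (wL : opponents_legal w).

Let Y s := fine (capital w s).
Let C := investor_capital p Y.
Let q t := p [seq Y i | i <- iota 1 t].
Let a t := (c + (1 - c) * q t)%R.
Let finite_upto t := forall s, (s <= t)%N -> capital w s = (Y s)%:E.

Let capital_ge0 s : 0 <= capital w s.
Proof. by case: s => //= s; have [_ []] := wL s. Qed.

Let Y0 : Y 0 = 1%R. Proof. by []. Qed.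

Let Y_ge0 s : (0 <= Y s)%R. Proof. exact/fine_ge0/capital_ge0. Qed.

Let c1' : (0 < 1 - c)%R. Proof. by rewrite subr_gt0. Qed.

Let G_incr : increasing_from1 G.
Proof.
case: F_incr => F0 Fmon; split=> [x x1|x y x1 xy].
  by rewrite divr_ge0 ?F0// ltW.
by rewrite ler_pM2r ?invr_gt0// Fmon.
Qed.

Let q_ge0 t : (0 <= q t)%R.
Proof. exact: SLA_position_ge0 G_incr pG Y0 Y_ge0. Qed.

Let a_ge0 t : (0 <= a t)%R.
Proof. by rewrite addr_ge0// mulr_ge0// ltW. Qed.

(** Once Sceptic's capital has been infinite, the limit of [F] stays due in all later rounds; a
    finite frozen capital can meet this because [c = 0] and it dominates all values of [F]. *)
Definition imitation_invariant t :=
  (finite_upto t /\ rival_capital w t = (c * Y t + (1 - c) * C t)%:E) \/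
  [/\ (exists2 s, (s <= t)%N & capital w s = +oo), 0 <= rival_capital w t &
     rival_capital w t = +oo \/
     c = 0%R /\ forall y, (1 <= y)%R -> (F y)%:E <= rival_capital w t].

Lemma rival_frozen t : (exists2 s, (s <= t)%N & capital w s = +oo) ->
  rival (w t) = fun=> rival_capital w t.
Proof.
move=> [[|s] // st ws]; rewrite wS /imitate capitals_mkseq last_rival_capitals.
by rewrite ifT// -ws; apply: map_f; rewrite mem_iota.
Qed.

Lemma rival_active t : finite_upto t ->
  rival_capital w t = (c * Y t + (1 - c) * C t)%:E ->
  rival (w t) = fun x =>
    ((1 - c) * (C t - q t * Y t))%:E + (a t)%:E * sceptic (w t) x.
Proof.
move=> fint K't; rewrite wS /imitate last_rival_capitals last_capitals.
rewrite capitals_mkseq K't ifF; last first.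
  apply/mapP => -[s]; rewrite mem_iota add1n ltnS => /andP[_ st].
  by rewrite fint.
rewrite -map_comp; apply/funext => x; congr (_%:E + _).
by rewrite /= -/(Y t) /q; under eq_map do rewrite -/(Y _); ring.
Qed.

Lemma imitation_step t : imitation_invariant t ->
  legal_bet (forecast (w t)) (rival (w t)) (rival_capital w t) /\
  imitation_invariant t.+1.
Proof.
have [Eprob [f0 Ef]] := wL t; case=> [[fint K't]|[oo K'0 K'oo]]; last first.
  split; last first.
    right; rewrite /= rival_frozen//; split=> //.
    by case: oo => s st; exists s => //; rewrite leqW.
  rewrite rival_frozen//; split=> //; case: Eprob => Emon EZ ED Ec.
  (* A content is prescribed on real constants only; for a frozen capital [+oo] the bound is
     trivial. *)
  by case: (rival_capital w t) K'0 => [r _|_|//]; rewrite ?Ec ?leey.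
have wt := rival_active fint K't; have [F0 Fmon] := F_incr.
(* A fall of the price to [0] shows [C t - q t * Y t >= G 1], so the constant part of Rival's bet is
   nonnegative. *)
have [CF _] : _ /\ _ := SLA_jump t (proj2 G_incr) pG Y0 Y_ge0 (lexx 0%R).
have C0 : (0 <= C t - q t * Y t)%R.
  rewrite -/C -/(q t) sub0r mulrN in CF; apply: le_trans CF.
  exact: (proj1 G_incr).
have b0 : (0 <= (1 - c) * (C t - q t * Y t))%R by rewrite mulr_ge0// ltW.
have f'0 x : 0 <= rival (w t) x.
  by rewrite wt adde_ge0 ?lee_fin ?mule_ge0 ?lee_fin// f0.
split.
  split=> //; rewrite wt K't; rewrite fint// in Ef.
  apply: le_trans (content_affine _ Eprob (a_ge0 t) Ef) _.
  by rewrite lee_fin le_eqVlt /a; apply/orP; left; apply/eqP; ring.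
rewrite /imitation_invariant /=.
have := f'0 (reality (w t)); rewrite wt.
have [|fin] := eqVneq (sceptic (w t) (reality (w t))) +oo.
  move=> foo; rewrite foo => f'x0; right; split=> //; first by exists t.+1.
  (* A positive coefficient on Sceptic's infinite bet makes Rival's capital infinite; otherwise both
     nonnegative terms of [a t] vanish. *)
  have := a_ge0 t; rewrite le_eqVlt => /predU1P[at0|at_gt0]; last first.
    by left; rewrite gt0_muley// addey.
  right; have [c00 q00] : c = 0%R /\ q t = 0%R.
    move/esym/eqP: at0; rewrite paddr_eq0 ?mulr_ge0 ?q_ge0 ?(ltW c1')//.
    by rewrite mulf_eq0 (gt_eqF c1') => /andP[/eqP-> /eqP->].
  split=> // y y1; rewrite -at0 mul0e adde0 lee_fin.
  (* With position [0], a jump to any [y] leaves Investor's capital unchanged, so it already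
     dominates [F y]. *)
  have [_ /(_ y1)] := SLA_jump t (proj2 G_incr) pG Y0 Y_ge0 (le_trans ler01 y1).
  by rewrite -/C -/(q t) q00 /G c00 subr0 divr1 !mul0r mul1r addr0 subr0.
have fxE : sceptic (w t) (reality (w t)) = (Y t.+1)%:E.
  by rewrite /Y/= fineK// ge0_fin_numE ?ltey.
move=> _; left; split.
  by move=> s; rewrite leq_eqVlt => /orP[/eqP->//|st]; apply: fint.
rewrite fxE; congr EFin; rewrite /C/= -/C -/(q t) /a; ring.
Qed.

Lemma imitation_invariantP t : imitation_invariant t.
Proof.
elim: t => [|t /imitation_step[]//]; left; split.
  by case=> // _; rewrite Y0.
by rewrite Y0 /= mulr1 mulr1 addrC subrK.
Qed.

Lemma imitation_ensures t :
  c%:E * capital w t + extend_oo F (max_capital w t) <= rival_capital w t.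
Proof.
have [F0 Fmon] := F_incr.
case: (imitation_invariantP t) => [[fint ->]|[[s st ws] _ K'oo]].
  rewrite (max_capital_running_max fint) fint//= lee_fin lerD2l.
  by rewrite mulrC -ler_pdivrMr//; exact: pG.
have -> : max_capital w t = +oo by apply/eqP; rewrite -leye_eq -ws le_max_capital.
case: K'oo => [->|[c00 FK]]; first exact: leey.
by rewrite c00 mul0e add0e; apply: extend_oo_le.
Qed.

End Imitation.

Lemma SLA_rival_can_ensure (F : R -> R) (c : R) : increasing_from1 F ->
  (0 <= c)%R -> (c < 1)%R -> SLA (fun y : R => (F y / (1 - c))%R) ->
  rival_can_ensure (fun w : play R X => forall t : nat,
    c%:E * capital w t + extend_oo F (max_capital w t) <= rival_capital w t).
Proof.
move=> F_incr c0 c1 [_ [p pF]]; exists (imitate c p) => w wS wL.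
split=> t; last exact: imitation_ensures pF wS wL t.
by case: (imitation_step c0 c1 F_incr pF wS wL
  (imitation_invariantP c0 c1 F_incr pF wS wL t)).
Qed.

End SLAToRival.

(** * Lower sums and the Azema-Yor strategy *)

Section LowerSums.
Variables (R : realType) (F : R -> R).
Implicit Types (y : nat -> R) (m x : R).
Local Open Scope ring_scope.

(** The integral against [du / u ^ 2] of the step function equal to [F (y i)] from [y i] to
    [y i.+1], and to [F (y n)] beyond [y n]. *)
Definition lower_sum y n : R :=
  \sum_(i < n) F (y i) * ((y i)^-1 - (y i.+1)^-1) + F (y n) / y n.

(* Lower sums over the partitions of [[m, oo)]: their supremum is the integral
   of [F u / u ^ 2] over [[m, oo)]. *)
Definition lower_sums m : set R :=
  [set s | exists y n, [/\ y 0%N = m, (forall i, y i <= y i.+1)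
                         & s = lower_sum y n.+1]].

Definition tail m : R := sup (lower_sums m).

Definition prepend m y i := if i is j.+1 then y j else m.

Lemma lower_sum_prepend m y n :
  lower_sum (prepend m y) n.+1 = F m * (m^-1 - (y 0%N)^-1) + lower_sum y n.
Proof. by rewrite /lower_sum big_ord_recl /= addrA. Qed.

Lemma lower_sums_prepend m x s : m <= x -> lower_sums x s ->
  lower_sums m (F m * (m^-1 - x^-1) + s).
Proof.
move=> mx [y [n [yx ymon ->]]]; exists (prepend m y), n.+1; split=> //.
  by case=> //=; rewrite yx.
by rewrite lower_sum_prepend yx.
Qed.

Lemma lower_sums_const m : lower_sums m (F m / m).
Proof.
exists (fun=> m), 0%N; split=> //.
by rewrite /lower_sum big_ord_recl big_ord0 subrr mulr0 !add0r.
Qed.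

Hypothesis F_incr : increasing_from1 F.
Hypothesis lower_sum_le1 : forall y n, y 0%N = 1 ->
  (forall i, y i <= y i.+1) -> lower_sum y n.+1 <= 1.

(** Prepending [1] to a partition adds a nonnegative term, so the bound for partitions from [1]
    carries over. *)
Lemma lower_sums_ub m : 1 <= m -> ubound (lower_sums m) 1.
Proof.
move=> m1 s /(lower_sums_prepend m1) [y [n [y0 ymon]]] E.
have := lower_sum_le1 n y0 ymon; rewrite -E; apply: le_trans.
rewrite lerDr mulr_ge0 ?(proj1 F_incr)// invr1 subr_ge0 invf_le1//.
exact: lt_le_trans m1.
Qed.

Lemma lower_sums_le_tail m s : 1 <= m -> lower_sums m s -> s <= tail m.
Proof.
by move=> m1 ms; apply: ub_le_sup ms; exists 1; exact: lower_sums_ub.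
Qed.

Lemma tail_le1 : tail 1 <= 1.
Proof.
by apply: ge_sup; [exists (F 1 / 1); exact: lower_sums_const|exact: lower_sums_ub].
Qed.

Lemma tail_ge m : 1 <= m -> F m / m <= tail m.
Proof. by move=> m1; apply: lower_sums_le_tail (lower_sums_const m). Qed.

(** For the integral: split it at [x] and use [F u >= F m] between [m] and [x]. *)
Lemma tail_step m x : 1 <= m -> m <= x ->
  F m * (m^-1 - x^-1) + tail x <= tail m.
Proof.
move=> m1 mx; rewrite -lerBrDl; apply: ge_sup.
  by exists (F x / x); exact: lower_sums_const.
move=> s xs; rewrite lerBrDl; apply: lower_sums_le_tail => //.
exact: lower_sums_prepend.
Qed.

(* Investor's capital dominates the Azema-Yor function
   [F M + (tail M - F M / M) X] of the current price [X] and its maximum [M];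
   his position is its slope in [X]. *)
Definition azema_yor : investor_strategy R := fun h =>
  let M := foldl Num.max 1 h in tail M - F M / M.

Lemma azema_yor_position (X : nat -> R) t : X 0%N = 1 ->
  foldl Num.max 1 [seq X i | i <- iota 1 t] = running_max X t.
Proof.
move=> X0; elim: t => [|t IH]; first by rewrite running_max0.
by rewrite -(addn1 t) iotaD map_cat foldl_cat IH /= add1n addn1 running_maxS.
Qed.

Lemma lower_sums_SLA : SLA F.
Proof.
split=> //; exists azema_yor => X X0 Xge0 t; set M := running_max X.
have M1 s : 1 <= M s by rewrite -X0 le_running_max.
have slope s : 0 <= tail (M s) - F (M s) / M s by rewrite subr_ge0 tail_ge.
(* The term in [X t] is nonnegative, so the Azema-Yor function exceeds [F (M t)]. *)
suff : F (M t) + (tail (M t) - F (M t) / M t) * X t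
    <= investor_capital azema_yor X t.
  by apply: le_trans; rewrite lerDl mulr_ge0.
elim: t => [|t IH].
  by rewrite /M running_max0 X0 /= divr1 mulr1 addrC subrK tail_le1.
rewrite /= /azema_yor azema_yor_position// -/(M t).
(* While [M t] is kept, Investor's gain is exactly the change of this affine function; only a new
   maximum needs an argument. *)
apply: le_trans (lerD IH (lexx _)); rewrite -addrA -mulrDr addrCA subrr addr0.
have -> : M t.+1 = Num.max (M t) (X t.+1) by rewrite /M running_maxS.
have [MX|//] := leP (M t) (X t.+1).
have MX0 : 0 < X t.+1 by rewrite (lt_le_trans _ MX)// (lt_le_trans _ (M1 t)).
have M0 : 0 < M t by rewrite (lt_le_trans _ (M1 t)).
(* At a new maximum [x] the function equals [tail x * x], so the claim is [tail_step] multiplied by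
   [x]. *)
have := ler_wpM2r (ltW MX0) (tail_step (M1 t) MX).
rewrite mulrDl mulrBr mulrBl -!mulrA mulVf ?gt_eqF// mulr1 => h.
rewrite [X in X <= _](_ : _ = tail (X t.+1) * X t.+1); last first.
  by rewrite mulrBl divfK ?gt_eqF// addrC subrK.
by rewrite mulrBl -mulrA; lra.
Qed.

End LowerSums.

(** * A two-point expectation as an outer probability content *)

Section TwoPointContent.
Variables (R : realType) (X : Type) (a b : X).

Lemma dual_addeM (c : R) (x y : \bar R) : (0 <= c)%R ->
  c%:E * dual_adde x y = dual_adde (c%:E * x) (c%:E * y).
Proof.
rewrite le_eqVlt => /predU1P[<-|c0]; first by rewrite !mul0e dual_adde_finl adde0.
by case: x y => [x| |] [y| |];
  rewrite ?gt0_muley ?gt0_muleNy ?lte_fin -?EFinM ?dual_adde_finl ?adde0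
    -?EFinD -?EFinM ?mulrDr ?gt0_muley ?gt0_muleNy ?lte_fin.
Qed.

Lemma dual_adde_ge0 (x y : \bar R) : 0 <= x -> 0 <= y -> dual_adde x y = x + y.
Proof. by case: x y => [x| |] [y| |]. Qed.

Definition two_point (q : R) (f : X -> \bar R) : \bar R :=
  dual_adde (q%:E * f b) ((1 - q)%:E * f a).

(** The expectation is additive for [dual_adde], even at infinite values, so subadditivity holds
    with equality. *)
Lemma two_point_content (q : R) : (0 <= q)%R -> (q <= 1)%R ->
  outer_probability_content (two_point q).
Proof.
move=> q0; rewrite -subr_ge0 => q1; rewrite /two_point; split.
- by move=> f g fg; apply: lee_dD; apply: lee_wpmul2l; rewrite ?lee_fin ?fg.
- move=> c f c0.
  rewrite (dual_addeM _ _ (ltW c0)).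
  by rewrite ![c%:E * (_%:E * _)]muleCA.
- move=> f g; rewrite !dual_addeM//.
  by rewrite le_eqVlt; apply/orP; left; apply/eqP; exact: daddeACA.
- by move=> c; rewrite -!EFinM dual_adde_finl -EFinD -mulrDl addrC subrK mul1r.
Qed.

End TwoPointContent.

(** * The play that a strategy of Rival generates against fixed moves *)

Section Follow.
Variables (R : realType) (X : Type) (S : rival_strategy R X).
Variables (E : nat -> (X -> \bar R) -> \bar R).
Implicit Types (f : nat -> X -> \bar R) (x : nat -> X).

Definition next_round f x (h : seq (round R X)) t : round R X :=
  Round (E t) (f t) (S h (E t) (f t)) (x t).

(** Each move of Rival depends on all completed rounds, so the recursion builds histories and the
    play is read off from them. *)
Fixpoint follow_history f x t : seq (round R X) :=
  if t is s.+1 then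
    rcons (follow_history f x s) (next_round f x (follow_history f x s) s)
  else [::].

Definition follow f x : play R X :=
  fun t => next_round f x (follow_history f x t) t.

Lemma mkseq_follow f x t : mkseq (follow f x) t = follow_history f x t.
Proof. by elim: t => // t IH; rewrite mkseqS IH. Qed.

Lemma rival_follows_follow f x : rival_follows S (follow f x).
Proof. by move=> t; rewrite mkseq_follow. Qed.

Lemma follow_history_eq f g x z t :
  (forall s, (s < t)%N -> f s = g s /\ x s = z s) ->
  follow_history f x t = follow_history g z t.
Proof.
elim: t => //= t IH fg; rewrite IH => [|s st]; last exact/fg/leqW.
by have [ft xt] := fg t (ltnSn t); rewrite /next_round ft xt.
Qed.

End Follow.

(** * From Rival's guarantee to a bound on lower sums *)

Section RivalToSLA.
Variables (R : realType) (X : Type) (a b : X) (ab : a <> b).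
Variables (F : R -> R) (c : R) (S : rival_strategy R X).
Hypothesis S_ensures : forall w : play R X,
  rival_follows S w -> opponents_legal w ->
  rival_legal w /\ (forall t : nat, (0 < t)%N ->
    c%:E * capital w t + extend_oo F (max_capital w t) <= rival_capital w t).

Variable y : nat -> R.
Hypotheses (y0 : y 0%N = 1%R) (y_mon : forall i, (y i <= y i.+1)%R).

(* Sceptic's capital either moves from [y t] to [y t.+1] or drops to [0], with
   chances that make this bet fair; in [ruin k] it drops in round [k.+1]. *)
Let E t := two_point a b (y t / y t.+1).
Let f k t (x : X) : \bar R :=
  if (t <= k)%N && `[< x = b >] then (y t.+1)%:E else 0.
Let x k t := if (t < k)%N then b else a.
Let ruin k : play R X := follow S E (f k) (x k).

Let y_ge1 t : (1 <= y t)%R.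
Proof. by elim: t => [|t]; rewrite ?y0// => /le_trans; apply. Qed.

Let y_gt0 t : (0 < y t)%R. Proof. exact: lt_le_trans (y_ge1 t). Qed.

Let y_le s t : (s <= t)%N -> (y s <= y t)%R.
Proof. exact: (homo_leq (@lexx _ _) (@le_trans _ _) y_mon). Qed.

Let q_ge0 t : (0 <= y t / y t.+1)%R. Proof. by rewrite divr_ge0// ltW. Qed.

Let q_le1 t : (y t / y t.+1 <= 1)%R. Proof. by rewrite ler_pdivrMr// mul1r. Qed.

Lemma ruin_capital k t : capital (ruin k) t = if (t <= k)%N then (y t)%:E else 0.
Proof.
case: t => [|t] /=; first by rewrite y0.
rewrite /f /x; case: ltnP => tk; first by rewrite (ltnW tk) (asboolT erefl).
by rewrite (asboolF ab) andbF.
Qed.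

Lemma ruin_legal k : opponents_legal (ruin k).
Proof.
move=> t; split; first exact: two_point_content.
rewrite ruin_capital; split=> [z|] /=.
  by rewrite /f; case: ifP => // _; rewrite lee_fin ltW.
rewrite /E /two_point /f (asboolT erefl) (asboolF ab) andbF mule0 andbT.
by case: ifP => _; rewrite ?mule0 -?EFinM dual_adde_finl adde0// divfK// gt_eqF.
Qed.

Lemma ruin_max_capital k t : (t <= k)%N -> max_capital (ruin k) t = (y t)%:E.
Proof.
move=> tk; apply/le_anti/andP; split; last first.
  by have := le_max_capital (ruin k) (leqnn t); rewrite ruin_capital tk.
apply: bigmax_le => [|[i /= it] _]; first exact: leNye.
by rewrite ruin_capital (leq_trans _ tk)// lee_fin y_le.
Qed.

Lemma ruin_max_capitalS k : max_capital (ruin k) k.+1 = (y k)%:E.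
Proof.
apply/le_anti/andP; split; last first.
  by have := le_max_capital (ruin k) (leqnSn k); rewrite ruin_capital leqnn.
apply: bigmax_le => [|[i /= _] _]; first exact: leNye.
rewrite ruin_capital; case: ifP => [ik|_]; last by rewrite lee_fin ltW.
by rewrite lee_fin y_le.
Qed.

Let ensures k := S_ensures (@rival_follows_follow _ _ S E (f k) (x k)) (ruin_legal k).

(** Up to Rival's move in round [k.+1] the two plays coincide: Reality can first differ after it. *)
Lemma ruin_rival_eq k n : (k <= n)%N -> rival (ruin n k) = rival (ruin k k).
Proof.
move=> kn; rewrite /ruin /follow /next_round /=.
have fE s : (s <= k)%N -> f n s = f k s.
  by move=> sk; apply/funext => z; rewrite /f sk (leq_trans sk kn).
rewrite fE// (@follow_history_eq _ _ S E (f n) (f k) (x n) (x k))// => s sk.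
by rewrite fE 1?ltnW// /x sk (leq_trans sk kn).
Qed.

(** This is the legality of Rival's bet, priced over the two branches of the round. *)
Lemma ruin_step n t : (t < n)%N ->
  (y t / y t.+1)%:E * rival_capital (ruin n) t.+1
    + ((1 - y t / y t.+1) * F (y t))%:E <= rival_capital (ruin n) t.
Proof.
move=> tn; have [/(_ t)[+ +] _] := ensures n.
rewrite -/(ruin n) [forecast _]/= => g0 Eg.
apply: le_trans Eg; rewrite /E /two_point.
(* The branch [a] is round [t.+1] of [ruin t]: Sceptic is ruined with maximum [y t], so Rival must
   hold [F (y t)]. *)
have ga : (F (y t))%:E <= rival (ruin n t) a.
  have [_ /(_ t.+1 erefl)] := ensures t.
  rewrite -/(ruin t) ruin_max_capitalS ruin_capital ltnn mule0 add0e.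
  by rewrite ruin_rival_eq 1?ltnW//= /x ltnn.
have -> : rival_capital (ruin n) t.+1 = rival (ruin n t) b by rewrite /= /x tn.
rewrite dual_adde_ge0 ?mule_ge0 ?lee_fin ?subr_ge0//.
by rewrite leeD2l// EFinM lee_wpmul2l// lee_fin subr_ge0.
Qed.

Lemma ruin_rival_capital n t : (t <= n)%N -> exists r : R,
  rival_capital (ruin n) t = r%:E /\
  (\sum_(i < t) F (y i) * ((y i)^-1 - (y i.+1)^-1) + r / y t <= 1)%R.
Proof.
elim: t => [|t IH] tn.
  by exists 1%R; rewrite big_ord0 y0 divr1 add0r.
have [r [rE rle]] := IH (ltnW tn); have := ruin_step tn; rewrite rE.
have [/(_ t)[g0 _] _] := ensures n; rewrite -/(ruin n) in g0.
have K0 : 0 <= rival_capital (ruin n) t.+1 by exact: g0.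
(* An infinite value on a branch of positive probability would exceed the finite capital before
   it. *)
case: (rival_capital _ _) K0 => [r' _|_|//]; last first.
  by rewrite gt0_muley ?lte_fin ?divr_gt0.
rewrite -EFinM -EFinD lee_fin => step; exists r'; split=> //.
(* Divided by [y t], the inequality of [ruin_step] produces the next term of the sum. *)
rewrite big_ord_recr /=; apply: le_trans rle; rewrite -addrA lerD2l.
rewrite ler_pdivlMr//; apply: le_trans step.
rewrite le_eqVlt; apply/orP; left; apply/eqP; field.
by rewrite !gt_eqF.
Qed.

Lemma rival_lower_sum n : (c + lower_sum F y n.+1 <= 1)%R.
Proof.
have [r [rE rle]] := ruin_rival_capital (leqnn n.+1).
(* In this play Sceptic still holds [y n.+1], his maximum; dividing the guarantee by it gives [c]
   and the last term of the lower sum. *)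
have [_ /(_ n.+1 erefl)] := ensures n.+1; rewrite -/(ruin n.+1).
rewrite ruin_max_capital// ruin_capital leqnn rE -EFinM -EFinD lee_fin => h.
apply: le_trans rle; rewrite /lower_sum addrCA lerD2l.
by rewrite -(ler_pM2r (y_gt0 n.+1)) mulrDl !divfK ?gt_eqF.
Qed.

End RivalToSLA.

(** Assuming the guarantee only for [0 < t] serves both equivalences; dividing [rival_lower_sum] by
    [1 - c] bounds the lower sums of [F / (1 - c)] by [1]. *)
Lemma rival_can_ensure_SLA (R : realType) (X : Type) (F : R -> R) (c : R) :
  (exists a b : X, a <> b) -> increasing_from1 F -> (c < 1)%R ->
  rival_can_ensure (fun w : play R X => forall t : nat, (0 < t)%N ->
    c%:E * capital w t + extend_oo F (max_capital w t) <= rival_capital w t) ->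
  SLA (fun y : R => (F y / (1 - c))%R).
Proof.
move=> [a [b ab]] [F0 Fmon] c1 [S S_ensures].
have c1' : (0 < 1 - c)%R by rewrite subr_gt0.
apply: lower_sums_SLA => [|y n y0 ymon].
  split=> [x x1|x y x1 xy]; first by rewrite divr_ge0 ?F0// ltW.
  by rewrite ler_pM2r ?invr_gt0// Fmon.
have := rival_lower_sum ab S_ensures y0 ymon n; rewrite addrC -lerBrDr.
rewrite -(ler_pM2r (_ : 0 < (1 - c)^-1)%R) ?invr_gt0// mulfV ?gt_eqF//.
apply: le_trans; rewrite le_eqVlt; apply/orP; left; apply/eqP.
rewrite /lower_sum mulrDl mulr_suml mulrAC; congr (_ + _)%R.
by apply: eq_bigr => i _; rewrite mulrAC.
Qed.

Theorem corollary9p1 (R : realType) (X : Type)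
    (X_two : exists a b : X, a <> b)
    (F : R -> R) (F_incr : increasing_from1 F) :
  (rival_can_ensure (fun w : play R X => forall t : nat, (0 < t)%N ->
      extend_oo F (max_capital w t) <= rival_capital w t)
   <-> SLA F)
  /\
  (forall c : R, (0 <= c)%R -> (c < 1)%R ->
   (rival_can_ensure (fun w : play R X => forall t : nat,
      c%:E * capital w t + extend_oo F (max_capital w t)
        <= rival_capital w t)
    <-> SLA (fun y : R => (F y / (1 - c))%R))).
Proof.
(* The first equivalence is the case [c = 0], up to the guarantee at time [0]. *)
have SLA0 : SLA (fun y : R => (F y / (1 - 0))%R) <-> SLA F.
  by under eq_fun do rewrite subr0 divr1.
split=> [|c c0 c1].
  split=> [[S SP]|/SLA0 FS].
    apply/SLA0/(rival_can_ensure_SLA X_two F_incr ltr01); exists S => w wS wL.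
    have [? Pw] := SP w wS wL; split=> // t t0; rewrite mul0e add0e; exact: Pw.
  have [S SP] := SLA_rival_can_ensure X F_incr (lexx 0%R) ltr01 FS.
  exists S => w wS wL; have [? Pw] := SP w wS wL; split=> // t _.
  by have := Pw t; rewrite mul0e add0e.
split=> [[S SP]|]; last exact: SLA_rival_can_ensure.
apply: (rival_can_ensure_SLA X_two F_incr c1); exists S => w wS wL.
by have [? Pw] := SP w wS wL; split=> // t _; exact: Pw.
Qed.
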